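(* Let $T$ be a tournament of diameter $d$ (in particular $T$ is strongly connected). (a) If $d=2$, then $3\le\overrightarrow{trc}(T)\le 5$. (b) If $d\ge 3$, then $2d-1\le\overrightarrow{trc}(T)\le 2d+7$.
   Context: A tournament is a digraph in which every two distinct vertices are joined by exactly one arc (in one direction), with no loops. The distance $d(u,v)$ is the length (number of arcs) of a shortest directed $u$–$v$ path, and the diameter is $\max_{u,v}d(u,v)$. A directed path is total-rainbow if its arcs and internal vertices all receive pairwise distinct colours under a total-colouring (colouring of vertices and arcs). $\overrightarrow{trc}(T)$ is the minimum number of colours in a total-colouring of $T$ such that every ordered pair $(u,v)$ of vertices is joined by a total-rainbow $u$–$v$ path. *)

(* Defs.v *)
From mathcomp Require Import all_boot.
Set Implicit Arguments. Unset Strict Implicit. Unset Printing Implicit Defensive.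

(* A (finite, simple) digraph is a relation [e] on a finite type of vertices:
   [e u v] says that there is an arc from [u] to [v]. *)

Definition is_min (P : nat -> Prop) (k : nat) : Prop :=
  P k /\ forall m, P m -> k <= m.

Definition tournament (T : finType) (e : rel T) : Prop :=
  irreflexive e /\ forall u v, u != v -> e u v (+) e v u.

(* The path visits [u :: p]; its length, i.e. number of arcs, is [size p]. *)
Definition dipath (T : finType) (e : rel T) (u v : T) (p : seq T) : bool :=
  [&& path e u p, last u p == v & uniq (u :: p)].

Definition is_dist (T : finType) (e : rel T) (u v : T) (k : nat) : Prop :=
  is_min (fun n => exists2 p, dipath e u v p & size p = n) k.

(* Every distance is required to be finite, so having a diameter entails
   strong connectedness. *)
Definition is_diameter (T : finType) (e : rel T) (d : nat) : Prop :=
  (forall u v, exists2 k, is_dist e u v k & k <= d) /\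
  (exists u v, is_dist e u v d).

Definition path_arcs (T : Type) (u : T) (p : seq T) : seq (T * T) :=
  pairmap pair u p.

(* The vertices of [u :: p] other than the first and the last one. *)
Definition internal_vertices (T : Type) (u : T) (p : seq T) : seq T :=
  behead (belast u p).

(* A total-colouring is a pair [cv], [ca] of a vertex and an arc colouring
   sharing the same palette [C]; the values of [ca] outside [e] are never used
   on paths, hence irrelevant. *)
Definition total_rainbow (T : finType) (C : eqType) (cv : T -> C)
    (ca : T * T -> C) (u : T) (p : seq T) : bool :=
  uniq (map ca (path_arcs u p) ++ map cv (internal_vertices u p)).

Definition total_rainbow_connected (T : finType) (e : rel T) (C : eqType)
    (cv : T -> C) (ca : T * T -> C) : Prop :=
  forall u v, exists2 p, dipath e u v p & total_rainbow cv ca u p.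

(* [is_trc e k]: the total rainbow connection number of [e] exists and is [k].
   Not every colour of the palette ['I_k] has to be used; this does not affect
   the minimum. *)
Definition is_trc (T : finType) (e : rel T) (k : nat) : Prop :=
  is_min (fun n => exists (cv : T -> 'I_n) (ca : T * T -> 'I_n),
            total_rainbow_connected e cv ca) k.

(* Main.v *)
Require Import Defs.
From Stdlib Require Import Classical_Prop.
From mathcomp Require Import all_boot zify.
Set Implicit Arguments. Unset Strict Implicit. Unset Printing Implicit Defensive.

(* Lower bound: a path realising the diameter has d arcs and d - 1 internal
   vertices.

   Diameter 2: fix a vertex a, with out-neighbourhood A and in-neighbourhood B.
   Every vertex of A has an out-neighbour in B and every vertex of B has an
   in-neighbour in A, so walks A -> B -> a -> A -> B with three arc
   colours serve all pairs except those from A to B, which are at distance at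
   most 2.

   Diameter d >= 3: let w in A be reached from all of A in at most two steps
   inside A, and let r in B reach all of B in at most two steps inside B (kings
   of subtournaments).  The vertices and arcs of a w-r path of length at most d
   get 2d + 1 private colours.  Walks towards w use three further colours, walks
   out of r three others, which leaves none for a itself: it is needed from B
   to w and from r to A, so it has to share a colour with A or with B.
   Sharing with B is harmless if B reaches w through A, sharing with A is
   harmless if r reaches A through B.  If both fail, some x0 in B is dominated
   by w and its in-neighbours in A, some y0 in A dominates r and its
   out-neighbours in B, and x0 -> a -> y0 can replace the w-r path. *)


(** * Least values, the lower bound and kings *)

Lemma is_min_le (P : nat -> Prop) (n : nat) :
  P n -> exists2 k, is_min P k & k <= n.
Proof.
elim/ltn_ind: n => n IHn Pn.
have [[m lt_mn Pm]|noP] := classic (exists2 m, m < n & P m).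
  have [k min_k le_km] := IHn m lt_mn Pm.
  by exists k => //; apply: leq_trans le_km (ltnW lt_mn).
exists n => //; split=> // m Pm; rewrite leqNgt.
by apply/negP => lt_mn; apply: noP; exists m.
Qed.

Lemma size_path_arcs (T : Type) (u : T) (p : seq T) :
  size (path_arcs u p) = size p.
Proof. exact: size_pairmap. Qed.

Lemma path_arcs_snd (T : Type) (u : T) (p : seq T) :
  map snd (path_arcs u p) = p.
Proof. by elim: p u => //= v p IHp u; rewrite IHp. Qed.

Lemma all_path_arcs (T : Type) (e : rel T) (u : T) (p : seq T) :
  path e u p = all (fun a => e a.1 a.2) (path_arcs u p).
Proof. by elim: p u => //= v p IHp u; rewrite IHp. Qed.

Lemma trc_ge_diameter (T : finType) (e : rel T) (d k : nat) :
  is_diameter e d -> is_trc e k -> 2 * d - 1 <= k.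
Proof.
move=> [_ [u [v [_ min_d]]]] [[cv [ca rain]] _].
have [p dip_p] := rain u v.
have le_dp : d <= size p by apply: min_d; exists p.
rewrite /total_rainbow => /card_uniqP card_p.
have := max_card [in map ca (path_arcs u p) ++ map cv (internal_vertices u p)].
rewrite card_p card_ord size_cat !size_map size_path_arcs.
by rewrite size_behead size_belast; lia.
Qed.

(** Maximal out-degree inside [S] suffices: a [y] missed by [r] in two steps would dominate [r] and
    all its out-neighbours in [S], so its out-degree would be larger. *)
Lemma tournament_king (T : finType) (e : rel T) (S : pred T) (x0 : T) :
    tournament e -> S x0 ->
  exists2 r, S r & forall y, S y ->
    [\/ y = r, e r y | exists v, [/\ S v, e r v & e v y]].
Proof.
move=> [irr tot] Sx0; pose out u := [set v | S v && e u v].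
have [r Sr max_r] := arg_maxnP (fun u => #|out u|) Sx0.
exists r => // y Sy.
have [->|neq_yr] := eqVneq y r; first by constructor 1.
have [ery|nery] := boolP (e r y); first by constructor 2.
have [/existsP[v /and3P[Sv erv evy]]|no2] :=
  boolP [exists v, [&& S v, e r v & e v y]].
  by constructor 3; exists v.
have eyr : e y r by move: (tot y r neq_yr); rewrite (negbTE nery) addbF.
have: #|out y| <= #|out r| := max_r y Sy; rewrite leqNgt => /negP[].
apply: proper_card; apply/properP; split; last first.
  by exists r; rewrite inE ?irr ?andbF // Sr.
apply/subsetP => v; rewrite !inE => /andP[Sv erv]; rewrite Sv /=.
have neq_yv : y != v by apply: contraNneq nery => ->.
move: (tot y v neq_yv); have [evy|_] := boolP (e v y); last by rewrite addbF.
by case/existsP: no2; exists v; rewrite Sv erv evy.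
Qed.

(** * Routes and their colours *)

Section Route.

(* An item is a vertex or an arc.  A route is a walk whose arcs and internal
   vertices lie in [Q] or carry pairwise distinct colours taken from [A]. *)
Variables (T : finType) (e : rel T) (Q : seq (T + T * T)).
Variable k : T + T * T -> nat.

Definition route (A : seq nat) (x y : T) : Prop :=
  exists p L, [/\ path [rel u v | e u v && (inr (u, v) \in Q ++ L)] x p,
    last x p = y, {in p, forall z, z != y -> inl z \in Q ++ L},
    uniq (map k L) & {subset map k L <= A}].

Lemma route_sub (A B : seq nat) (x y : T) :
  all (mem B) A -> route A x y -> route B x y.
Proof.
move=> /allP AB [p [L [e_p last_p in_p uniqL LA]]].
by exists p, L; split=> // c /LA/AB.
Qed.

Lemma route_refl (x : T) : route [::] x x.
Proof. by exists [::], [::]. Qed.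

Lemma route_arc (x y : T) : e x y -> route [:: k (inr (x, y))] x y.
Proof.
move=> exy; exists [:: y], [:: inr (x, y)]; split=> //=.
  by rewrite exy mem_cat mem_head orbT.
by move=> z; rewrite inE => /eqP->; rewrite eqxx.
Qed.

Lemma route_arcQ (x y : T) : e x y -> inr (x, y) \in Q -> route [::] x y.
Proof.
move=> exy Qxy; exists [:: y], [::]; split=> //=.
  by rewrite exy mem_cat Qxy.
by move=> z; rewrite inE => /eqP->; rewrite eqxx.
Qed.

(** [V] treats two cases at once: it is empty when the joint [v] lies in [Q], and [[:: v]] when [v]
    is charged its own colour. *)
Let route_cat_gen (V : seq T) (A B : seq nat) (x v y : T) :
    inl v \in Q ++ map inl V -> uniq (map (k \o inl) V ++ A ++ B) ->
  route A x v -> route B v y -> route (map (k \o inl) V ++ A ++ B) x y.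
Proof.
move=> Qv uniqAB [p [L [e_p last_p in_p uniqL LA]]].
move=> [q [M [e_q last_q in_q uniqM MB]]].
have subL z : z \in Q ++ L -> z \in Q ++ (map inl V ++ L ++ M).
  by rewrite !mem_cat => /orP[]->; rewrite ?orbT.
have subM z : z \in Q ++ M -> z \in Q ++ (map inl V ++ L ++ M).
  by rewrite !mem_cat => /orP[]->; rewrite ?orbT.
exists (p ++ q), (map inl V ++ L ++ M); split.
- rewrite cat_path last_p; apply/andP; split.
    by apply: sub_path e_p => u w /= /andP[-> /subL].
  by apply: sub_path e_q => u w /= /andP[-> /subM].
- by rewrite last_cat last_p.
- move=> z; rewrite mem_cat => /orP[pz _|qz neq_zy].
    (* The end [v] of the first walk becomes internal, so it now has to be a listed item. *)
    have [->|neq_zv] := eqVneq z v; last exact/subL/in_p.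
    by move: Qv; rewrite !mem_cat => /orP[]->; rewrite ?orbT.
  exact/subM/in_q.
- move: uniqAB; rewrite !map_cat -map_comp !cat_uniq.
  case/and3P=> -> /hasPn disjV /and3P[_ /hasPn disjAB _] /=.
  rewrite uniqL uniqM andbT /=; apply/andP; split.
    apply/hasPn => c; rewrite mem_cat => cLM; apply: disjV; rewrite mem_cat.
    by case/orP: cLM => [/LA|/MB] ->; rewrite ?orbT.
  by apply/hasPn => c /MB/disjAB; apply: contra => /LA.
move=> c; rewrite !map_cat -map_comp !mem_cat.
by case/or3P=> [->|/LA->|/MB->]; rewrite ?orbT.
Qed.

Lemma route_catQ (A B : seq nat) (x v y : T) :
    inl v \in Q -> uniq (A ++ B) ->
  route A x v -> route B v y -> route (A ++ B) x y.
Proof. by move=> Qv; apply: (@route_cat_gen [::]); rewrite cats0. Qed.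

Lemma route_cat (A B : seq nat) (x v y : T) :
    uniq (k (inl v) :: A ++ B) ->
  route A x v -> route B v y -> route (k (inl v) :: A ++ B) x y.
Proof. by apply: (@route_cat_gen [:: v]); rewrite mem_cat mem_head orbT. Qed.

Lemma route_walk (x : T) (p : seq T) :
    path e x p -> {subset map inl p <= Q} ->
  {subset map inr (path_arcs x p) <= Q} -> route [::] x (last x p).
Proof.
elim: p x => [|y p IHp] x /=; first by move=> *; apply: route_refl.
case/andP=> exy e_p Qp Qa.
apply: (@route_catQ [::] [::] x y) => //; first by apply: Qp; rewrite mem_head.
  by apply: route_arcQ => //; apply: Qa; rewrite mem_head.
by apply: IHp => // z z_p; [apply: Qp | apply: Qa]; rewrite inE z_p orbT.
Qed.

(* Items of [Q] get private colours, placed above the [c] colours used by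
   [k]; a route then uses every colour at most once, even if it is not a
   simple path. *)
Variables (c n : nat).
Hypothesis kc : forall z, k z < c.
Hypothesis Qn : c + size Q <= n.+1.

Definition route_colour (z : T + T * T) : 'I_n.+1 :=
  inord (if z \in Q then c + index z Q else k z).

(** Private colours start at [c], above all values of [k]; repetitions in [Q] are harmless, since
    [index] finds the first occurrence. *)
Lemma route_colour_inj (L : seq (T + T * T)) :
  uniq (map k L) -> {in Q ++ L &, injective route_colour}.
Proof.
move=> uniqL z1 z2 Qz1 Qz2 /(congr1 val) /=.
(* All colours are at most [n], so [inord] never falls back to its default 0. *)
have col_lt z : (if z \in Q then c + index z Q else k z) < n.+1.
  case: ifP => [Qz|_]; first by apply: leq_trans Qn; rewrite ltn_add2l index_mem.
  by apply: leq_trans (kc z) (leq_trans (leq_addr _ _) Qn).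
rewrite !inordK //; move: Qz1 Qz2; rewrite !mem_cat.
have k_neq z m : c + m <> k z by move=> cm; move: (kc z); rewrite -cm; lia.
case: ifP => Qz1; case: ifP => Qz2 //=.
- by move=> _ _ /addnI; apply: index_inj.
- by move=> _ _ /k_neq.
- by move=> _ _ /esym/k_neq.
move=> Lz1 Lz2 eq_k; move/(uniqP 0): uniqL => inj_k.
rewrite -(nth_index z1 Lz1) -(nth_index z1 Lz2); congr nth; apply: inj_k.
- by rewrite inE size_map index_mem.
- by rewrite inE size_map index_mem.
by rewrite !(nth_map z1) ?index_mem // !nth_index.
Qed.

(** Shortening the walk to a simple path adds no item, so its arcs and internal vertices stay in
    [Q ++ L], where the colouring is injective. *)
Lemma route_rainbow (A : seq nat) (x y : T) : route A x y ->
  exists2 p, dipath e x y p &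
    total_rainbow (route_colour \o inl) (route_colour \o inr) x p.
Proof.
move=> [p0 [L [e_p0 last_p0 in_p0 uniqL _]]].
case: (shortenP e_p0) last_p0 => p e_p uniq_p sub_p last_p.
exists p; first rewrite /dipath last_p eqxx uniq_p !andbT.
  by apply: sub_path e_p => u v /= /andP[].
rewrite /total_rainbow (map_comp _ inl) (map_comp _ inr) -map_cat map_inj_in_uniq.
  rewrite cat_uniq !map_inj_uniq; try by move=> ? ? [].
  apply/and3P; split.
  - by apply: (@map_uniq _ _ snd); rewrite path_arcs_snd; case/andP: uniq_p.
  - by apply/hasPn => z /mapP[v _ ->]; apply/mapP => -[].
  rewrite /internal_vertices -drop1 drop_uniq //.
  by move: uniq_p; rewrite lastI rcons_uniq => /andP[].
apply: sub_in2 (route_colour_inj uniqL) => z.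
rewrite [z \in map _ _ ++ _]mem_cat => /orP[] /mapP[a a_p ->].
  by move: e_p; rewrite all_path_arcs => /allP/(_ a a_p) /andP[_]; case: (a).
case/lastP: p {e_p} => [|q w] in uniq_p sub_p last_p a_p *; first by [].
move: a_p; rewrite /internal_vertices belast_rcons /= => a_q.
move: last_p; rewrite last_rcons => def_w; apply: in_p0.
  by apply: sub_p; rewrite mem_rcons inE a_q orbT.
apply: contraTneq uniq_p => def_a.
by rewrite /= rcons_uniq def_w -def_a a_q !andbF.
Qed.

Lemma route_trc (A : seq nat) : (forall x y, route A x y) ->
  exists2 m, is_trc e m & m <= n.+1.
Proof.
move=> routes; apply: is_min_le.
exists (route_colour \o inl), (route_colour \o inr) => x y.
exact/route_rainbow/routes.
Qed.

End Route.


(** * Tournaments of diameter two *)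

Lemma diameter_walk (T : finType) (e : rel T) (d : nat) :
  is_diameter e d ->
  forall u v, exists p, [/\ path e u p, last u p = v & size p <= d].
Proof.
move=> [dist_d _] u v; have [k [[p dip_p size_p] _] le_kd] := dist_d u v.
by case/and3P: dip_p => e_p /eqP last_p _; exists p; rewrite size_p.
Qed.

Lemma tournament_asym (T : finType) (e : rel T) (u v : T) :
  tournament e -> e u v -> e v u = false.
Proof.
move=> [irr tot] euv; have neq_uv : u != v.
  by apply: contraTneq euv => ->; rewrite irr.
by move: (tot u v neq_uv); rewrite euv; case: (e v u).
Qed.

Lemma tournament_cases (T : finType) (e : rel T) (a x : T) :
  tournament e -> [\/ x = a, e a x | e x a].
Proof.
move=> [_ tot]; have [->|neq_xa] := eqVneq x a; first by constructor 1.
move: (tot x a neq_xa); have [ax|_] := boolP (e a x); first by constructor 2.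
by rewrite addbF; constructor 3.
Qed.

Lemma trc_diameter2 (T : finType) (e : rel T) :
  tournament e -> is_diameter e 2 -> exists2 m, is_trc e m & m <= 5.
Proof.
move=> tour diam; have [irr _] := tour; have [_ [a _]] := diam.
have dist2 u v : [\/ u = v, e u v | exists2 w, e u w & e w v].
  have [[|w [|v' [|? ?]]] [/= e_p last_p le_p2]] := diameter_walk diam u v => //.
  - by constructor 1.
  - by constructor 2; rewrite -last_p; case/andP: e_p.
  - by constructor 3; exists w; rewrite -?last_p; case/and3P: e_p.
(* Arcs leaving [a] get 0, arcs entering it 1, arcs from its out- to its in-neighbours 2. All other
   arcs reuse 0, so that an arc inside one side combines with a crossing arc. *)
pose k (z : T + T * T) := match z with
  | inl v => if v == a then 3 else 4
  | inr (u, v) => if u == a then 0 else if v == a then 1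
                  else if e a u && e v a then 2 else 0
  end.
have neqO x : e a x -> (x == a) = false.
  by move=> ax; apply: contraTF ax => /eqP->; rewrite irr.
have neqI x : e x a -> (x == a) = false.
  by move=> xa; apply: contraTF xa => /eqP->; rewrite irr.
have asym := fun u v => @tournament_asym _ e u v tour.
pose rt := route e [::] k.
have fromO x : e a x -> rt [:: 0] a x.
  by move=> ax; have := route_arc [::] k ax; rewrite /= eqxx.
have toI x : e x a -> rt [:: 1] x a.
  by move=> xa; have := route_arc [::] k xa; rewrite /= eqxx (neqI x).
have across x y : e a x -> e y a -> e x y -> rt [:: 2] x y.
  move=> ax ya xy; have := route_arc [::] k xy.
  by rewrite /= (neqO x) ?(neqI y) ?ax ?ya.
have inO x y : e a x -> e a y -> e x y -> rt [:: 0] x y.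
  move=> ax ay xy; have := route_arc [::] k xy.
  by rewrite /= !neqO // (asym a y) ?andbF.
have inI x y : e x a -> e y a -> e x y -> rt [:: 0] x y.
  move=> xa ya xy; have := route_arc [::] k xy.
  by rewrite /= !neqI // (asym x a).
have outO x : e a x -> rt [:: 4; 2; 1] x a.
  move=> ax; have [xE|xa|[b xb ba]] := dist2 x a.
  - by rewrite xE irr in ax.
  - by rewrite (asym a x) in xa.
  have := @route_cat _ e [::] k [:: 2] [:: 1] x b a.
  by rewrite /= (neqI b) //; apply=> //; [apply: across | apply: toI].
have intoI y : e y a -> rt [:: 4; 0; 2] a y.
  move=> ya; have [yE|ay|[b ab yb]] := dist2 a y.
  - by rewrite yE irr in ya.
  - by rewrite (asym y a) in ay.
  have := @route_cat _ e [::] k [:: 0] [:: 2] a b y.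
  by rewrite /= (neqO b) //; apply=> //; [apply: fromO | apply: across].
have via_a (A B : seq nat) x y : uniq (3 :: A ++ B) ->
    rt A x a -> rt B a y -> rt (3 :: A ++ B) x y.
  by have := @route_cat _ e [::] k A B x a y; rewrite /= eqxx.
apply: (@route_trc _ e [::] k 5 4 _ _ [:: 0; 1; 2; 3; 4]) => //.
  by move=> [v|[u v]] /=; do ![case: ifP => // _].
move=> x y; have [->|neq_xy] := eqVneq x y.
  by apply: route_sub (route_refl _ _ _ _).
have [->|ax|xa] := tournament_cases a x tour;
  have [yE|ay|ya] := tournament_cases a y tour.
- by rewrite yE; apply: route_sub (route_refl _ _ _ _).
- exact: route_sub (fromO y ay).
- exact: route_sub (intoI y ya).
- by rewrite yE; exact: route_sub (outO x ax).
- exact: route_sub (via_a _ _ _ _ _ (outO x ax) (fromO y ay)).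
(* A detour through [a] would repeat the colours 2 and 4. On a path of length two, the middle vertex
   lies on one side of [a], and the arcs have colours 0 and 2 in some order. *)
- have [xE|xy|[w xw wy]] := dist2 x y; first by rewrite xE eqxx in neq_xy.
    exact: route_sub (across x y ax ya xy).
  have [wE|aw|wa] := tournament_cases a w tour.
  + by rewrite wE (asym a x) in xw.
  + have := @route_cat _ e [::] k [:: 0] [:: 2] x w y.
    rewrite /= (neqO w) // => r.
    by apply: route_sub (r _ (inO x w ax aw xw) (across w y aw ya wy)).
  + have := @route_cat _ e [::] k [:: 2] [:: 0] x w y.
    rewrite /= (neqI w) // => r.
    by apply: route_sub (r _ (across x w ax wa xw) (inI w y wa ya wy)).
- by rewrite yE; exact: route_sub (toI x xa).
- exact: route_sub (via_a _ _ _ _ _ (toI x xa) (fromO y ay)).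
- exact: route_sub (via_a _ _ _ _ _ (toI x xa) (intoI y ya)).
Qed.


(** * Tournaments of diameter at least three *)

Lemma tournament_rev (T : finType) (e : rel T) :
  tournament e -> tournament (fun u v => e v u).
Proof. by move=> [irr tot]; split=> // u v /tot; rewrite addbC. Qed.

(** If [x] is not dominated, some [v] that is [w] or points to [w] has no arc to [x]. As [v] and [x]
    lie on opposite sides of [a], the arc goes from [x] to [v] and leads to [w]. *)
Lemma tournament_reach_or_dominated (T : finType) (e : rel T) (a w : T) :
    tournament e -> e a w ->
  (forall x, e x a -> e x w \/ exists v, [/\ e a v, e x v & e v w]) \/
  (exists2 x, e x a & forall v, e a v -> v = w \/ e v w -> e v x).
Proof.
move=> tour aw; have asym := fun u v => @tournament_asym _ e u v tour.
have [ex|noex] :=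
  classic (exists2 x, e x a & forall v, e a v -> v = w \/ e v w -> e v x).
  by right.
left=> x xa; apply: NNPP => noreach; apply: noex; exists x => // v av vw.
have [xE|//|xv] := tournament_cases v x tour.
  by rewrite xE (asym a v) in xa.
case: noreach; case: vw => [<-|vw]; first by left.
by right; exists v.
Qed.

(* [b] tells whether [a] shares its colour with its out-neighbours ([true]) or
   with its in-neighbours ([false]). *)
Lemma trc_hub (T : finType) (e : rel T) (d : nat) (a w r : T) (p : seq T)
    (b : bool) :
    tournament e -> e a w -> e r a ->
    (forall x, e a x -> [\/ x = w, e x w
                         | exists v, [/\ e a v, e x v & e v w]]) ->
    (forall y, e y a -> [\/ y = r, e r y
                         | exists v, [/\ e v a, e r v & e v y]]) ->
    (if b then forall y, e a y -> e r y \/ exists v, [/\ e v a, e r v & e v y]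
     else forall x, e x a -> e x w \/ exists v, [/\ e a v, e x v & e v w]) ->
    path e w p -> last w p = r -> size p <= d ->
  exists2 m, is_trc e m & m <= 2 * d + 7.
Proof.
move=> tour aw ra to_w from_r reach_b e_p last_p le_pd.
have [irr _] := tour; have asym := fun u v => @tournament_asym _ e u v tour.
have irrF u v : e u v -> (u == v) = false.
  by move=> uv; apply: contraTF uv => /eqP->; rewrite irr.
have irrF' u v : e u v -> (v == u) = false by rewrite eq_sym; apply: irrF.
have neq12 u v : e a u -> e v a -> (u == v) = false.
  by move=> au; apply: contraTF => /eqP<-; rewrite asym.
have neq21 u v : e a u -> e v a -> (v == u) = false.
  by move=> au va; rewrite eq_sym neq12.
(* Walks to [w] use 1 on the last arc, 0 on the arc before and 2 on the vertex between; walks out of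
   [r] use 3, then 4, with 5 between. Arcs joining the two sides of [a] get 4 or 0, according to
   which walks need them through [reach_b]. *)
pose k (z : T + T * T) := match z with
  | inl v => if v == a then if b then 2 else 5 else if e a v then 2 else 5
  | inr (u, v) =>
      if v == w then 1 else if u == r then 3
      else if v == a then 0 else if u == a then 4
      else if e a u && e a v then 0 else if e u a && e v a then 4
      else if b then 4 else 0
  end.
pose Q := map (@inl T (T * T)) (w :: p) ++ map inr (path_arcs w p).
have arc u v (uv : e u v) := route_arc Q k uv.
have two A B x v y := @route_cat _ e Q k A B x v y.
have Qw : inl w \in Q by rewrite mem_cat mem_head.
have Qr : inl r \in Q by rewrite mem_cat map_f // -last_p mem_last.
have mid : route e Q k [::] w r.
  rewrite -last_p; apply: route_walk => // z z_p.
    by rewrite mem_cat /= inE z_p orbT.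
  by rewrite mem_cat z_p orbT.
have kw x : e x w -> route e Q k [:: 1] x w.
  by move=> xw; have := arc _ _ xw; rewrite /= eqxx.
have kr y : y != w -> e r y -> route e Q k [:: 3] r y.
  by move=> /negPf yw ry; have := arc _ _ ry; rewrite /= yw eqxx.
have wN : (a == w) = false by apply: irrF.
have rN : (a == r) = false by apply: irrF'.
(* [r] is excluded because its outgoing arcs have colour 3 unless they end in [w]; dually [exit]
   excludes [w], whose incoming arcs all have colour 1. *)
have entry x : x != r -> route e Q k [:: 0; 1; 2] x w.
  move=> neq_xr; have [->|ax|xa] := tournament_cases a x tour.
  - exact: route_sub (kw a aw).
  - have [->|xw|[v [av xv vw]]] := to_w x ax.
    + by apply: route_sub (route_refl _ _ _ _).
    + exact: route_sub (kw x xw).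
    have := two [:: 0] [:: 1] x v w; have := arc _ _ xv.
    rewrite /= !(irrF' a) // irrF // (negPf neq_xr) ax av => xv_r r2.
    by apply: route_sub (r2 _ xv_r (kw v vw)).
  (* An in-neighbour [x] of [a] goes to [w] through [a] if [a] has colour 2, and by [reach_b]
     otherwise. *)
  case: b @k @Q arc two Qw Qr mid kw kr reach_b
    => k Q arc two Qw Qr mid kw kr reach_b.
    have := two [:: 0] [:: 1] x a w; have := arc _ _ xa.
    rewrite /= !eqxx wN (negPf neq_xr) => xa_r r2.
    by apply: route_sub (r2 _ xa_r (kw a aw)).
  have [xw|[v [av xv vw]]] := reach_b x xa; first exact: route_sub (kw x xw).
  have := two [:: 0] [:: 1] x v w; have := arc _ _ xv.
  rewrite /= (irrF' a v) // (irrF v w) // (irrF x a) // (negPf neq_xr) av.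
  rewrite (asym x a) //= (asym a v) // andbF => xv_r r2.
  by apply: route_sub (r2 _ xv_r (kw v vw)).
have exit y : y != w -> route e Q k [:: 3; 4; 5] r y.
  move=> neq_yw; have [->|ay|ya] := tournament_cases a y tour.
  - by apply: route_sub (kr a _ ra); rewrite ?wN.
  - case: b @k @Q arc two Qw Qr mid kw kr entry reach_b
      => k Q arc two Qw Qr mid kw kr entry reach_b.
      have [ry|[v [va rv vy]]] := reach_b y ay.
        exact: route_sub (kr y _ ry).
      have := two [:: 3] [:: 4] r v y; have := arc _ _ vy.
      rewrite /= (irrF v a) // (irrF' a y) // (irrF' r v) // (negPf neq_yw).
      rewrite (asym v a) //= (asym a y) // andbF => vy_r r2.
      by apply: route_sub (r2 _ (kr v _ rv) vy_r); rewrite ?neq21.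
    have := two [:: 3] [:: 4] r a y; have := arc _ _ ay.
    rewrite /= !eqxx rN (irrF' a y) // (negPf neq_yw) => ay_r r2.
    by apply: route_sub (r2 _ (kr a _ ra) ay_r); rewrite ?wN.
  have [->|ry|[v [va rv vy]]] := from_r y ya.
  - by apply: route_sub (route_refl _ _ _ _).
  - exact: route_sub (kr y _ ry).
  have := two [:: 3] [:: 4] r v y; have := arc _ _ vy.
  rewrite /= (irrF v a) // (irrF y a) // (irrF' r v) // (negPf neq_yw).
  rewrite (asym v a) //= va ya => vy_r r2.
  by apply: route_sub (r2 _ (kr v _ rv) vy_r); rewrite ?neq21.
have -> : 2 * d + 7 = (2 * d + 6).+1 by rewrite addnS.
apply: (@route_trc _ e Q k 6 _ _ _ [:: 0; 1; 2; 3; 4; 5]).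
- by move=> [v|[u v]] /=; do ![case: ifP => // _].
- by rewrite size_cat !size_map size_path_arcs /=; lia.
move=> x y; have [->|neq_xr] := eqVneq x r; have [->|neq_yw] := eqVneq y w.
(* From [r] to [w] neither [entry] nor [exit] applies; the way through [a] has arc colours 3 and 1,
   and [a] has 2 or 5. *)
- have := two [:: 3] [:: 1] r a w => r2.
  have := r2 _ (kr a _ ra) (kw a aw).
  rewrite /= eqxx wN; case: (b) => r3; exact: route_sub (r3 _ _).
- exact: route_sub (exit y _).
- exact: route_sub (entry x _).
have xr := route_catQ Qw _ (entry x neq_xr) mid.
exact: route_sub (route_catQ Qr _ (xr _) (exit y neq_yw)).
Qed.

(** Every vertex other than [a] reaches [a] directly or through [x0], and is reached from [a]
    directly or through [y0]. Six shared colours and six private ones suffice, whatever the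
    diameter. *)
Lemma trc_double_hub (T : finType) (e : rel T) (a x0 y0 : T) :
    tournament e -> e x0 a -> e a y0 ->
    (forall x, e a x -> e x x0 \/ exists v, [/\ e a v, e x v & e v x0]) ->
    (forall y, e y a -> e y0 y \/ exists v, [/\ e v a, e y0 v & e v y]) ->
  exists2 m, is_trc e m & m <= 12.
Proof.
move=> tour xa0 ay0 to_x0 from_y0.
have [irr _] := tour; have asym := fun u v => @tournament_asym _ e u v tour.
have irrF u v : e u v -> (u == v) = false.
  by move=> uv; apply: contraTF uv => /eqP->; rewrite irr.
have irrF' u v : e u v -> (v == u) = false by rewrite eq_sym; apply: irrF.
pose k (z : T + T * T) := match z with
  | inl v => if e a v then 2 else 5
  | inr (u, v) =>
      if v == a then 0 else if u == a then 4
      else if e a u && e a v then 0 else if e u a && e v a then 4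
      else if v == x0 then 1 else 3
  end.
(* An arc from [y0] to [x0] may both end a walk into [x0] and start one out of [y0]. It would need
   the colours 1 and 3 at once, so it gets a private one. *)
pose Q : seq (T + T * T) := [:: inl x0; inl a; inl y0;
  inr (x0, a); inr (a, y0); inr (y0, x0)].
have arc u v (uv : e u v) := route_arc Q k uv.
have two A B x v y := @route_cat _ e Q k A B x v y.
have Qa : inl a \in Q by rewrite !inE eqxx ?orbT.
have Qx0 : inl x0 \in Q by rewrite !inE eqxx.
have Qy0 : inl y0 \in Q by rewrite !inE eqxx ?orbT.
have xa0_r : route e Q k [::] x0 a.
  by apply: route_arcQ => //; rewrite !inE eqxx ?orbT.
have ay0_r : route e Q k [::] a y0.
  by apply: route_arcQ => //; rewrite !inE eqxx ?orbT.
have kx x : e a x -> e x x0 -> route e Q k [:: 1] x x0.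
  move=> ax xx0; have := arc _ _ xx0.
  rewrite /= eqxx (irrF x0 a) // (irrF' a x) // (asym a x) //.
  by rewrite (asym x0 a) // andbF.
have ky y : e y a -> e y0 y -> route e Q k [:: 3] y0 y.
  move=> ya y0y; have [yx0|neq_yx0] := eqVneq y x0.
    apply: (@route_sub _ _ _ _ [::]) => //; apply: route_arcQ => //.
    by rewrite yx0 !inE eqxx ?orbT.
  have := arc _ _ y0y.
  rewrite /= (irrF y a) // (irrF' a y0) // (asym a y0) // (asym y a) // andbF.
  by rewrite (negPf neq_yx0).
have entry x : route e Q k [:: 0; 1; 2] x a.
  have [->|ax|xa] := tournament_cases a x tour.
  - by apply: route_sub (route_refl _ _ _ _).
  - have [xx0|[v [av xv vx0]]] := to_x0 x ax.
      by apply: route_sub (route_catQ Qx0 _ (kx x ax xx0) xa0_r).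
    have := two [:: 0] [:: 1] x v x0; have := arc _ _ xv.
    rewrite /= !(irrF' a) // ax av => xv_r r2.
    by apply: route_sub (route_catQ Qx0 _ (r2 _ xv_r (kx v av vx0)) xa0_r).
  by have := arc _ _ xa; rewrite /= eqxx; apply: route_sub.
have exit y : route e Q k [:: 3; 4; 5] a y.
  have [->|ay|ya] := tournament_cases a y tour.
  - by apply: route_sub (route_refl _ _ _ _).
  - by have := arc _ _ ay; rewrite /= eqxx (irrF' a y) //; apply: route_sub.
  have [y0y|[v [va y0v vy]]] := from_y0 y ya.
    by apply: route_sub (route_catQ Qy0 _ ay0_r (ky y ya y0y)).
  have := two [:: 3] [:: 4] y0 v y; have := arc _ _ vy.
  rewrite /= !(irrF _ a) // (asym v a) //= va ya => vy_r r2.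
  by apply: route_sub (route_catQ Qy0 _ ay0_r (r2 _ (ky v va y0v) vy_r)).
apply: (@route_trc _ e Q k 6 11 _ _ [:: 0; 1; 2; 3; 4; 5]) => //.
  by move=> [v|[u v]] /=; do ![case: ifP => // _].
move=> x y; exact: route_sub (route_catQ Qa _ (entry x) (exit y)).
Qed.

Lemma trc_diameter_ge3 (T : finType) (e : rel T) (d : nat) :
    tournament e -> is_diameter e d -> 3 <= d ->
  exists2 m, is_trc e m & m <= 2 * d + 7.
Proof.
move=> tour diam ge_d3; have [_ [a [b [_ min_d]]]] := diam.
have neq_ab : a != b.
  apply/eqP => ab; suff: d <= 0 by lia.
  by apply: min_d; exists [::] => //; rewrite /dipath /= ab eqxx.
have walk := diameter_walk diam.
have [v av] : exists v, e a v.
  have [[|v p] [/= e_p last_p _]] := walk a b.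
    by rewrite last_p eqxx in neq_ab.
  by exists v; case/andP: e_p.
have [u ua] : exists u, e u a.
  have [p [e_p last_p _]] := walk b a; case/lastP: p => [|p z] in e_p last_p *.
    by rewrite -last_p /= eqxx in neq_ab.
  exists (last b p); move: e_p last_p.
  by rewrite rcons_path last_rcons => /andP[_ +] <-.
(* Reversing the arcs turns a king among the out-neighbours of [a] into a vertex [w] that they all
   reach. *)
have [w aw to_w] := tournament_king (tournament_rev tour) (av : e a v).
have [r ra from_r] := @tournament_king _ e (e^~ a) u tour ua.
have to_w' x : e a x -> [\/ x = w, e x w | exists v, [/\ e a v, e x v & e v w]].
  case/to_w=> [|?|[v' []]]; [by constructor 1 | by constructor 2 |].
  by constructor 3; exists v'.
have [p [e_p last_p le_pd]] := walk w r.
have [reach_w|[x0 xa0 dom_x0]] := tournament_reach_or_dominated tour aw.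
  exact: (@trc_hub _ e d a w r p false).
have [reach_r|[y0 ay0 dom_y0]] :=
  @tournament_reach_or_dominated _ (fun u v => e v u) a r
    (tournament_rev tour) ra.
  apply: (@trc_hub _ e d a w r p true) => // y /reach_r[|[z []]]; first by left.
  by right; exists z.
(* Since [w] and its in-neighbours among the out-neighbours of [a] point to [x0], each way to [w]
   can end in [x0] instead; dually for [r] and [y0]. As [d] is at least 3, 12 is within the
   bound. *)
have [||m trc_m le_m] := @trc_double_hub _ e a x0 y0 tour xa0 ay0.
- move=> x /[dup] ax /to_w'[xw|xw|[z [az xz zw]]].
  + by left; apply: dom_x0; auto.
  + by left; apply: dom_x0; auto.
  by right; exists z; split=> //; apply: dom_x0; auto.
- move=> y /[dup] ya /from_r[yr|ry|[z [za rz zy]]].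
  + by left; apply: dom_y0; auto.
  + by left; apply: dom_y0; auto.
  by right; exists z; split=> //; apply: dom_y0; auto.
by exists m => //; lia.
Qed.

Theorem theorem20 (T : finType) (e : rel T) (d : nat)
    (tour_e : tournament e) (diam_e : is_diameter e d) :
  (d = 2 -> exists2 k, is_trc e k & 3 <= k <= 5) /\
  (3 <= d -> exists2 k, is_trc e k & 2 * d - 1 <= k <= 2 * d + 7).
Proof.
split=> [d2|ge_d3].
  rewrite d2 in diam_e; have [k trc_k le_k] := trc_diameter2 tour_e diam_e.
  by exists k; rewrite // (trc_ge_diameter diam_e trc_k).
have [k trc_k le_k] := trc_diameter_ge3 tour_e diam_e ge_d3.
by exists k; rewrite // (trc_ge_diameter diam_e trc_k).
Qed.
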